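(* Let $D\subset\mathbb{R}^n$ be a convex domain and $p\in\partial D$. If $p$ is a strictly convex boundary point of $D$, then $\lim_{x\to p,\,x\in D} s_D(x)=1$.
   Context: A projective map of $\mathbb{R}^n\subset\mathbb{P}\mathbb{R}^n$ is a (linear-fractional) map induced by a linear map of $\mathbb{R}^{n+1}$ acting on homogeneous coordinates, where $\mathbb{R}^n$ is embedded as the points $(1:x_1:\dots:x_n)$. For a domain $D\subset\mathbb{R}^n$ and $z\in D$, the (projective) squeezing function is $s_D(z)=\sup\{r>0:\ \exists$ a projective map $\Phi$ with $\Phi(z)=0$, $\Phi(D)\subset B(0,1)$ and $B(0,r)\subset\Phi(D)\}$ (open Euclidean balls), with $s_D(z)=0$ if no such $\Phi$ exists. A point $p\in\partial D$ is strictly convex if $\partial D$ is $\mathcal{C}^2$-smooth in a neighborhood of $p$ and the restriction to the tangent hyperplane at $p$ of the Hessian of a (local) defining function of $D$ is positive definite. *)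

(* Defs.v *)
From HB Require Import structures.
From mathcomp Require Import all_boot all_order all_algebra.
From mathcomp Require Import all_classical all_reals all_analysis.
Set Implicit Arguments. Unset Strict Implicit. Unset Printing Implicit Defensive.
Import Order.TTheory GRing.Theory Num.Theory.
Import numFieldNormedType.Exports.
Local Open Scope classical_set_scope.
Local Open Scope ring_scope.

Definition enorm {R : realType} {n : nat} (x : 'rV[R]_n) : R :=
  Num.sqrt (\sum_(i < n) x 0 i ^+ 2).

Definition eball {R : realType} {n : nat} (c : 'rV[R]_n) (r : R) : set 'rV[R]_n :=
  [set x | enorm (x - c) < r].

Definition homog {R : realType} {n : nat} (x : 'rV[R]_n) : 'rV[R]_(1 + n) :=
  row_mx (const_mx 1) x.

(* The projective map induced by the linear map A of R^(n+1) (acting on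
   row vectors by right multiplication): it is defined at x when the
   0-th homogeneous coordinate of the image is nonzero. *)
Definition proj_defined {R : realType} {n : nat} (A : 'M[R]_(1 + n)) (x : 'rV[R]_n) : Prop :=
  (lsubmx (homog x *m A)) 0 0 != 0.

Definition proj_map {R : realType} {n : nat} (A : 'M[R]_(1 + n)) (x : 'rV[R]_n) : 'rV[R]_n :=
  ((lsubmx (homog x *m A)) 0 0)^-1 *: rsubmx (homog x *m A).

Definition squeeze_radii {R : realType} {n : nat} (D : set 'rV[R]_n) (z : 'rV[R]_n) : set R :=
  [set r | 0 < r /\
     exists A : 'M[R]_(1 + n),
       [/\ A \in unitmx,
           (forall x, D x -> proj_defined A x),
           proj_map A z = 0,
           (forall x, D x -> eball 0 1 (proj_map A x)) &
           eball 0 r `<=` proj_map A @` D]].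

Definition squeezing {R : realType} {n : nat} (D : set 'rV[R]_n) (z : 'rV[R]_n) : R :=
  if pselect (exists r, squeeze_radii D z r) then sup (squeeze_radii D z) else 0.

Definition domain {R : realType} {n : nat} (D : set 'rV[R]_n) : Prop :=
  [/\ open D, connected D & D !=set0].

Definition convex_domain_set {R : realType} {n : nat} (D : set 'rV[R]_n) : Prop :=
  forall x y t, D x -> D y -> 0 <= t -> t <= 1 -> D ((1 - t) *: x + t *: y).

Definition boundary_pt {R : realType} {n : nat} (D : set 'rV[R]_n) (p : 'rV[R]_n) : Prop :=
  closure D p /\ ~ interior D p.

Definition ebasis {R : realType} {n : nat} (i : 'I_n) : 'rV[R]_n := delta_mx 0 i.

Definition partial {R : realType} {n : nat} (i : 'I_n) (f : 'rV[R]_n -> R) (x : 'rV[R]_n) : R :=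
  derive f x (ebasis i).

Definition C2_on {R : realType} {n : nat} (U : set 'rV[R]_n) (f : 'rV[R]_n -> R) : Prop :=
  forall x, U x ->
    [/\ f @ x --> f x,
        (forall i, derivable f x (ebasis i)),
        (forall i, partial i f @ x --> partial i f x),
        (forall i j, derivable (partial i f) x (ebasis j)) &
        (forall i j, partial j (partial i f) @ x --> partial j (partial i f) x)].

(* p is a strictly convex boundary point of D: near p, dD is C^2, given by a
   local defining function rho (D /\ U = {rho < 0}, d rho(p) <> 0), and the
   Hessian of rho at p restricted to the tangent hyperplane
   T_p = {v | sum_i v_i d_i rho(p) = 0} is positive definite. *)
Definition strictly_convex_pt {R : realType} {n : nat} (D : set 'rV[R]_n) (p : 'rV[R]_n) : Prop :=
  exists (U : set 'rV[R]_n) (rho : 'rV[R]_n -> R),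
    [/\ open U /\ U p, C2_on U rho,
        (forall x, U x -> (D x <-> rho x < 0)),
        (exists i, partial i rho p != 0) &
        (forall v : 'rV[R]_n, v != 0 ->
           \sum_(i < n) v 0 i * partial i rho p = 0 ->
           0 < \sum_(i < n) \sum_(j < n) v 0 i * v 0 j * partial j (partial i rho) p)].

(* Main.v *)
Require Import Defs.
From HB Require Import structures.
From mathcomp Require Import all_boot all_order all_algebra ring lra.
From mathcomp Require Import all_classical all_reals all_analysis.
Import Order.TTheory GRing.Theory Num.Theory.
Import numFieldNormedType.Exports.
Local Open Scope classical_set_scope.
Local Open Scope ring_scope.

(* Let rho be a defining function near p, z in D close to p, s = - rho z > 0,
   L the differential of rho at z, H its Hessian at p and E the squared Euclidean
   norm.  By Taylor's formula (near z) and convexity (far from z), D - z lies in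
   the quadric {- s + L + H/2 - eps E - M L^2 < 0}, with M independent of z.
   Completing the square in the homogeneous coordinate rewrites this as
   P < s (1 - L/(2s))^2 with P = H/2 - eps E + (1/(4s) - M) L^2, and P is positive
   definite once s is small, because H is positive definite on the kernel of L.
   Writing P(v) = |v S|^2, the projective map
   z + v |-> v S / (sqrt s (1 - L(v)/(2s))) sends z to 0 and D into the unit ball.
   The preimage of B(0, r) has size O(sqrt s) around z, so it is governed by Taylor's
   formula, and it lies in D when eps and s are small compared to 1 - r. *)

Set Implicit Arguments. Unset Strict Implicit. Unset Printing Implicit Defensive.

(** * Quadratic forms and Cholesky factorization *)

Definition sqn {R : realType} {n : nat} (v : 'rV[R]_n) : R := \sum_i v 0 i ^+ 2.

Definition qform {R : realType} {n : nat} (P : 'M[R]_n) (v : 'rV[R]_n) : R :=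
  (v *m P *m v^T) 0 0.

Lemma sqn_mul {R : realType} {n : nat} (v : 'rV[R]_n) : sqn v = (v *m v^T) 0 0.
Proof. by rewrite mxE; apply: eq_bigr => i _; rewrite mxE expr2. Qed.

Lemma sqn_ge0 {R : realType} {n : nat} (v : 'rV[R]_n) : 0 <= sqn v.
Proof. by apply: sumr_ge0 => i _; exact: sqr_ge0. Qed.

Lemma sqn_gt0 {R : realType} {n : nat} (v : 'rV[R]_n) : v != 0 -> 0 < sqn v.
Proof.
move=> v0; rewrite lt_neqAle sqn_ge0 andbT; apply: contra v0 => /eqP/esym/eqP.
rewrite psumr_eq0 => [/allP h|i _]; last exact: sqr_ge0.
apply/eqP/rowP => i; rewrite mxE; apply/eqP.
by have := h i (mem_index_enum _); rewrite sqrf_eq0.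
Qed.

Lemma sqnZ {R : realType} {n : nat} (a : R) (v : 'rV[R]_n) :
  sqn (a *: v) = a ^+ 2 * sqn v.
Proof. by rewrite /sqn mulr_sumr; apply: eq_bigr => i _; rewrite mxE exprMn. Qed.

Lemma qformZ {R : realType} {n : nat} (P : 'M[R]_n) (a : R) (v : 'rV[R]_n) :
  qform P (a *: v) = a ^+ 2 * qform P v.
Proof.
by rewrite /qform linearZ /= -!scalemxAl -scalemxAr scalerA mxE expr2.
Qed.

Lemma qform_sum {R : realType} {n : nat} (P : 'M[R]_n) (v : 'rV[R]_n) :
  qform P v = \sum_i \sum_j v 0 i * v 0 j * P i j.
Proof.
rewrite /qform mxE exchange_big; apply: eq_bigr => j _ /=.
rewrite !mxE big_distrl; apply: eq_bigr => i _ /=.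
by rewrite -!mulrA [P _ _ * _]mulrC.
Qed.

(** Induction on the dimension, splitting off the first coordinate: the Schur complement
    [C - a^-1 *: (b *m b^T)] inherits positive definiteness. *)
Lemma cholesky {R : realType} {n : nat} (P : 'M[R]_n) :
  P^T = P -> (forall v : 'rV_n, v != 0 -> 0 < qform P v) ->
  exists S : 'M[R]_n, P = S *m S^T.
Proof.
elim: n P => [|n IH] P.
  by move=> _ _; exists 0; apply/matrixP => -[].
rewrite -[n.+1]/(1 + n)%N in P *.
move=> symP posP.
pose a := P 0 0; pose b := dlsubmx P; pose C := drsubmx P.
have ulE : ulsubmx P = a%:M.
  by apply/matrixP => i j; rewrite !ord1 !mxE eqxx mulr1n; congr (P _ _); exact: val_inj.
have urE : ursubmx P = b^T by rewrite -{1}symP trmx_dlsub.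
have CT : C^T = C by rewrite /C -[in RHS]symP trmx_drsub.
have PE : P = block_mx a%:M b^T b C by rewrite -ulE -urE submxK.
have qE x w : qform P (row_mx x%:M w) =
    a * x ^+ 2 + 2 * x * (w *m b) 0 0 + qform C w.
  rewrite {1}PE /qform mul_row_block tr_row_mx mul_row_col !mulmxDl tr_scalar_mx.
  rewrite -!mulmxA; have -> : b^T *m w^T = (w *m b)^T by rewrite trmx_mul.
  rewrite !mul_scalar_mx !mul_mx_scalar.
  rewrite !mulmxA -scalemxAr; set c := w *m b; set d := w *m C *m w^T; clearbody c d.
  by rewrite !mxE eqxx !mulr1n; ring.
have a0 : 0 < a.
  have := posP (row_mx 1%:M 0); rewrite qE /qform !mul0mx !mxE expr1n mulr1 mulr0 !addr0; apply.
  apply/eqP => /(congr1 lsubmx); rewrite row_mxKl linear0 => /matrixP/(_ 0 0)/eqP.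
  by rewrite !mxE oner_eq0.
have [||S SE] := IH (C - a^-1 *: (b *m b^T)).
- by rewrite linearB /= linearZ /= trmx_mul trmxK CT.
- move=> w w0.
  (* This first coordinate minimizes [qform P] among vectors with tail [w]; the minimum is the Schur
     complement form at [w]. *)
  have : 0 < qform P (row_mx (- (w *m b) 0 0 / a)%:M w).
    apply: posP; apply: contra w0 => /eqP e0.
    by apply/eqP; rewrite -[w](row_mxKr (- (w *m b) 0 0 / a)%:M) e0 linear0.
  rewrite qE; suff -> : qform (C - a^-1 *: (b *m b^T)) w =
     a * (- (w *m b) 0 0 / a) ^+ 2 + 2 * (- (w *m b) 0 0 / a) * (w *m b) 0 0 + qform C w by [].
  rewrite /qform mulmxBr mulmxBl -scalemxAr -scalemxAl mulmxA.
  have -> : w *m b *m b^T *m w^T = (w *m b) *m (w *m b)^T by rewrite trmx_mul !mulmxA.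
  set c := w *m b; set d := w *m C *m w^T; clearbody c d.
  rewrite !mxE big_ord1 !mxE.
  by field; rewrite gt_eqF.
exists (block_mx (Num.sqrt a)%:M 0 ((Num.sqrt a)^-1 *: b) S).
have sa : Num.sqrt a * Num.sqrt a = a by rewrite -expr2 sqr_sqrtr ?ltW.
have sa0 : Num.sqrt a != 0 by rewrite gt_eqF ?sqrtr_gt0.
rewrite tr_block_mx mulmx_block PE !tr_scalar_mx !trmx0 !mulmx0 !mul0mx !addr0.
rewrite -scalar_mxM sa mul_scalar_mx mul_mx_scalar linearZ /= !scalerA mulfV // !scale1r.
rewrite -scalemxAl -scalemxAr scalerA -invfM sa -SE.
by rewrite addrCA subrr addr0.
Qed.

(** Passing to the symmetric part leaves the quadratic form unchanged, and a nonzero vector killed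
    by [S] would make the form vanish. *)
Lemma cholesky_qform {R : realType} {n : nat} (P : 'M[R]_n) :
  (forall v : 'rV_n, v != 0 -> 0 < qform P v) ->
  exists2 S : 'M[R]_n, S \in unitmx & forall v, qform P v = sqn (v *m S).
Proof.
move=> posP; have symE v : qform (2^-1 *: (P + P^T)) v = qform P v.
  have tE : (v *m P^T *m v^T) 0 0 = (v *m P *m v^T) 0 0.
    rewrite -[in RHS](trmxK (v *m P *m v^T)) [in RHS]mxE.
    by rewrite trmx_mul trmxK trmx_mul mulmxA.
  rewrite /qform -scalemxAr -scalemxAl mulmxDr mulmxDl !mxE.
  move: tE; by rewrite !mxE => ->; field.
have [||S SE] := @cholesky R n (2^-1 *: (P + P^T)).
- by rewrite linearZ /= linearD /= trmxK addrC.
- by move=> w /posP; rewrite symE.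
have qS v : qform P v = sqn (v *m S).
  by rewrite -symE /qform SE sqn_mul trmx_mul !mulmxA.
exists S => //.
rewrite -row_free_unit; apply/row_freeP/row_freeP; rewrite -kermx_eq0.
apply/negPn/negP => /rowV0Pn [v /sub_kermxP vS0 v0].
by have := posP v v0; rewrite qS vS0 sqn_mul mul0mx mxE ltxx.
Qed.

(** * First and second order Taylor estimates from partial derivatives *)

Lemma normv_coord {R : realType} {n : nat} (v : 'rV[R]_n) i : `|v 0 i| <= `|v|.
Proof.
rewrite [leRHS]mx_normrE.
exact: (le_bigmax _ (fun ij : 'I_1 * 'I_n => `|v ij.1 ij.2|) (0, i)).
Qed.

Lemma normv_le {R : realType} {n : nat} (v : 'rV[R]_n) (c : R) :
  0 <= c -> (forall i, `|v 0 i| <= c) -> `|v| <= c.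
Proof.
move=> c0 h; rewrite [leLHS]mx_normrE; apply/bigmax_leP; split=> // -[j i] _ /=.
by rewrite ord1.
Qed.

Lemma is_derive_line {R : realType} {n : nat} (f : 'rV[R]_n -> R) (x v : 'rV[R]_n) (t : R) :
  derivable f (x + t *: v) v ->
  is_derive t 1 (fun s => f (x + s *: v)) ('D_v f (x + t *: v)).
Proof.
move=> df.
have e : (fun h : R =>
      h^-1 *: (((fun s => f (x + s *: v)) \o shift t) (h *: (1 : R)) - f (x + t *: v)))
       = (fun h => h^-1 *: ((f \o shift (x + t *: v)) (h *: v) - f (x + t *: v))).
  apply/funext => h /=; rewrite [h *: 1]mulr1 scalerDl; congr (_ *: (f _ - _)).
  by rewrite addrCA addrC.
split.
  by rewrite /derivable e.
by rewrite /derive e.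
Qed.

(** The minimum and maximum let [b - a] have either sign, as the coordinates of a vector do. *)
Lemma mean_value_le {R : realType} (g dg : R -> R) (a b c m : R) :
  (forall s, Num.min a b <= s -> s <= Num.max a b ->
     is_derive s 1 g (dg s) /\ `|dg s - c| <= m) ->
  `|g b - g a - c * (b - a)| <= m * `|b - a|.
Proof.
wlog ab : a b / a <= b => [H|].
  have [ab|/ltW ba] := leP a b.
    by have := H a b ab; rewrite min_l // max_r.
  have := H b a ba; rewrite min_l // max_r // => H1 /H1.
  rewrite -normrN [in leRHS]distrC; congr (`|_| <= _); ring.
rewrite min_l // max_r // => h.
have gd t : t \in `]a, b[ -> is_derive t 1 g (dg t).
  by rewrite in_itv /= => /andP[/ltW ? /ltW ?]; have [] := h t.
have gc : {within `[a, b], continuous g}.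
  apply: derivable_within_continuous => s; rewrite in_itv /= => /andP[? ?].
  by have [//|//|[]] := h s.
have [t tI ->] := MVT_segment ab gd gc.
rewrite -mulrBl normrM ler_wpM2r //.
by move: tI; rewrite in_itv /= => /andP[? ?]; have [] := h t.
Qed.

(** Fixed slopes [a] make this usable twice: for the first-order expansion of a function, and for
    the increments of its partial derivatives in [taylor2]. *)
Lemma coord_lipschitz {R : realType} {n : nat} (f : 'rV[R]_n -> R)
    (a : 'I_n -> R) (p : 'rV[R]_n) (d eta : R) :
  (forall y, `|y - p| < d -> forall i, derivable f y (ebasis i) /\ `|partial i f y - a i| <= eta) ->
  forall x v, `|x - p| < d -> `|x + v - p| < d ->
   `|f (x + v) - f x - \sum_i v 0 i * a i| <= eta * \sum_i `|v 0 i|.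
Proof.
move=> hf x v hx hxv.
(* Changing one coordinate at a time stays within the sup-norm ball. *)
pose w (k : nat) : 'rV[R]_n := x + \row_i (if (i < k)%N then v 0 i else 0).
have w0 : w 0%N = x by rewrite /w; apply/rowP => i; rewrite !mxE addr0.
have wn : w n = x + v by rewrite /w; apply/rowP => i; rewrite !mxE ltn_ord.
have step (k : 'I_n) : `|f (w k.+1) - f (w k) - v 0 k * a k| <= eta * `|v 0 k|.
  have wS : w k.+1 = w k + v 0 k *: ebasis k.
    apply/rowP => i; rewrite !mxE eqxx /= -addrA; congr (_ + _).
    rewrite ltnS leq_eqVlt; case: (eqVneq i k) => [->|ik].
      by rewrite eqxx ltnn add0r mulr1.
    by rewrite -[(i == k :> nat)]/(i == k) (negPf ik) mulr0 addr0.
  (* Each coordinate of this point lies between those of [x] and [x + v], so its sup-norm distance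
     to [p] is at most the larger of theirs. *)
  have yd s : Num.min 0 (v 0 k) <= s -> s <= Num.max 0 (v 0 k) ->
      `|w k + s *: ebasis k - p| < d.
    move=> s0 s1; apply: (@le_lt_trans _ _ (Num.max `|x - p| `|x + v - p|)).
      apply: normv_le => [|i]; first by rewrite le_max normr_ge0.
      rewrite le_max; have := normv_coord (x - p) i; have := normv_coord (x + v - p) i.
      rewrite !mxE eqxx /=; case: (eqVneq i k) => [->|ik].
        rewrite ltnn addr0 mulr1 => h1 h2; apply/orP.
        move: s0 s1; rewrite ge_min le_max => /orP s0 /orP s1.
        have [h|h] := leP `|x - p| `|x + v - p|; [right|left]; rewrite ler_norml;
          move: h1 h2; rewrite !ler_norml => /andP[? ?] /andP[? ?];
          case: s0 => ?; case: s1 => ?; lra.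
      by rewrite mulr0 addr0; case: ifP => _ h1 h2; rewrite ?addr0 ?h1 ?h2 ?orbT.
    by rewrite gt_max hx.
  have := @mean_value_le _ (fun s => f (w k + s *: ebasis k))
    (fun s => partial k f (w k + s *: ebasis k)) 0 (v 0 k) (a k) eta.
  rewrite subr0 scale0r addr0 -wS [a k * _]mulrC; apply => s s0 s1.
  have [df le_eta] := hf _ (yd s s0 s1) k.
  by split; [exact: is_derive_line df|exact: le_eta].
rewrite -wn -{1}w0.
have -> : f (w n) - f (w 0%N) = \sum_(i < n) (f (w i.+1) - f (w i)).
  by rewrite -(big_mkord xpredT (fun i => f (w i.+1) - f (w i))) telescope_sumr.
rewrite -sumrB mulr_sumr; apply: le_trans (ler_norm_sum _ _ _) _.
by apply: ler_sum.
Qed.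

Lemma near_ball {R : realType} {n : nat} (p : 'rV[R]_n) (P : 'rV[R]_n -> Prop) :
  (\forall y \near p, P y) -> exists2 d : R, 0 < d & forall y, `|y - p| < d -> P y.
Proof.
move=> /nbhs_ballP[d /= d0 h]; exists d => // y yp; apply: h.
by rewrite -ball_normE /= distrC.
Qed.

Lemma near_partials {R : realType} {n : nat} (f : 'rV[R]_n -> R) (x : 'rV[R]_n) (eta : R) :
  (\forall y \near x, forall i, derivable f y (ebasis i)) ->
  (forall i, partial i f @ x --> partial i f x) -> 0 < eta ->
  exists2 d : R, 0 < d & forall y, `|y - x| < d -> forall i,
    derivable f y (ebasis i) /\ `|partial i f y - partial i f x| <= eta.
Proof.
move=> df cf eta0; apply: near_ball.
have : \forall y \near x, forall i, `|partial i f y - partial i f x| <= eta.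
  apply: (@filter_forall _ _ (fun i y => `|partial i f y - partial i f x| <= eta) (nbhs x) _) => i.
  have /cvgrPdist_le/(_ _ eta0) := cf i.
  by apply: filterS => y; rewrite distrC.
by apply: filterS2 df => y h1 h2 i.
Qed.

Lemma is_derive_C1 {R : realType} {n : nat} (f : 'rV[R]_n -> R) (x v : 'rV[R]_n) :
  (\forall y \near x, forall i, derivable f y (ebasis i)) ->
  (forall i, partial i f @ x --> partial i f x) ->
  is_derive x v f (\sum_i v 0 i * partial i f x).
Proof.
move=> df cf; set s := \sum_i _.
suff h : h^-1 *: ((f \o shift x) (h *: v) - f x) @[h --> 0^'] --> s.
  by split; [exact: cvgP h|exact: cvg_lim h].
pose V := \sum_i `|v 0 i|.
have V0 : 0 <= V by exact: sumr_ge0.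
apply/cvgrPdist_le => e e0.
have eV0 : 0 < e / (V + 1) by rewrite divr_gt0 // ltr_wpDl.
have [d d0 hd] := near_partials df cf eV0.
have hl := @coord_lipschitz R n f (fun i => partial i f x) x d (e / (V + 1)) hd.
have d'0 : 0 < d / (`|v| + 1) by rewrite divr_gt0 // ltr_wpDl.
near=> h.
have h0 : h != 0 by near: h; exact: nbhs_dnbhs_neq.
have hs : `|h| < d / (`|v| + 1).
  near: h; apply: dnbhs0_lt; exact: d'0.
have hv : `|h *: v| < d.
  rewrite normrZ; move: hs; rewrite ltr_pdivlMr ?ltr_wpDl //; apply: le_lt_trans.
  by rewrite ler_wpM2l // lerDl.
have := hl x (h *: v); rewrite subrr normr0 addrAC subrr add0r => /(_ d0 hv).
have -> : \sum_i (h *: v) 0 i * partial i f x = h * s.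
  by rewrite mulr_sumr; apply: eq_bigr => i _; rewrite !mxE mulrA.
have -> : \sum_i `|(h *: v) 0 i| = `|h| * V.
  by rewrite mulr_sumr; apply: eq_bigr => i _; rewrite !mxE normrM.
move=> H.
have -> : s - h^-1 *: ((f \o shift x) (h *: v) - f x) = - (h^-1 * (f (x + h *: v) - f x - h * s)).
  by rewrite /= [h *: v + x]addrC -[_ *: (_ : R)]/(_ * _); field.
rewrite normrN normrM normfV ler_pdivrMl ?normr_gt0 //; apply: le_trans H _.
rewrite mulrCA ler_wpM2l // mulrAC ler_pdivrMr ?ltr_wpDl //.
by rewrite ler_wpM2l ?(ltW e0) // lerDl.
Unshelve. all: by end_near. Qed.

Lemma is_derive_quadratic {R : realType} (t a b : R) :
  is_derive t (1 : R) (fun s => s * a + 2^-1 * s ^+ 2 * b) (a + t * b).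
Proof.
have -> : (fun s : R => s * a + 2^-1 * s ^+ 2 * b) =
    (a \*: (id : R -> R)) + ((2^-1 * b) \*: ((id : R -> R) ^+ 2)).
  apply/funext => s.
  change (s * a + 2^-1 * s ^+ 2 * b = a * s + 2^-1 * b * s ^+ 2); ring.
have d1 := is_derive_id t (1 : R).
apply: (is_derive_eq (is_deriveD (is_deriveZ a d1)
  (is_deriveZ (2^-1 * b) (is_deriveX 2 d1)))).
change (a * 1 + (2^-1 * b) * ((2%:R * t ^+ 1) * 1) = a + t * b); by field.
Qed.

(** The gradient is taken at the moving point [z] but the Hessian at the fixed [p], so one radius
    and one quadratic form serve all [z] near [p]. The remainder is bounded by the mean value
    inequality along the segment. *)
Lemma taylor2 {R : realType} {n : nat} (U : set 'rV[R]_n) (f : 'rV[R]_n -> R)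
    (p : 'rV[R]_n) (eps : R) :
  open U -> U p -> C2_on U f -> 0 < eps ->
  exists2 d : R, 0 < d & forall z v, `|z - p| < d -> `|z + v - p| < d ->
    `|f (z + v) - f z - \sum_i v 0 i * partial i f z
      - 2^-1 * \sum_i \sum_j v 0 i * v 0 j * partial j (partial i f) p|
    <= eps * (\sum_i `|v 0 i|) ^+ 2.
Proof.
move=> oU Up C2 eps0.
have nU x : U x -> \forall y \near x, U y by move=> Ux; exact: open_nbhs_nbhs.
have [d0 d00 hU] := near_ball (nU p Up).
have /near_ball[d1 d10 hd1] : \forall y \near p, forall i j,
    derivable (partial i f) y (ebasis j) /\
    `|partial j (partial i f) y - partial j (partial i f) p| <= eps.
  apply: (@filter_forall _ _ (fun i y => forall j, derivable (partial i f) y (ebasis j) /\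
     `|partial j (partial i f) y - partial j (partial i f) p| <= eps) (nbhs p) _) => i.
  have [||d d_gt0 hd] := @near_partials R n (partial i f) p eps _ _ eps0.
  - by apply: filterS (nU p Up) => y /C2[_ _ _ ddf _]; exact: ddf.
  - by case: (C2 p Up) => _ _ _ _ cddf; exact: cddf.
  apply/nbhs_ballP; exists d => //= y; rewrite -ball_normE /= distrC => yp j.
  exact: hd.
exists (Num.min d0 d1); first by rewrite lt_min d00.
move=> z v zp zvp; pose W := \sum_i `|v 0 i|.
have seg t : 0 <= t -> t <= 1 -> `|z + t *: v - p| < Num.min d0 d1.
  move=> t0 t1; have -> : z + t *: v - p = (1 - t) *: (z - p) + t *: (z + v - p).
    by apply/rowP => i; rewrite !mxE; ring.
  apply: le_lt_trans (ler_normD _ _) _; rewrite !normrZ !ger0_norm ?subr_ge0 //.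
  have := ler_wpM2l t0 (ltW zvp).
  have [->|tn1] := eqVneq t 1; first by rewrite subrr mul0r add0r !mul1r.
  have : 0 < 1 - t by rewrite subr_gt0 lt_neqAle tn1.
  by move=> h1 h2; have := ltr_pM2l h1 `|z - p| (Num.min d0 d1); rewrite zp; lra.
set A := \sum_i v 0 i * partial i f z.
set H := \sum_i \sum_j _.
(* Derivative of [f] minus its quadratic model along the segment; its terms are bounded by
   [coord_lipschitz] applied to each [partial i f]. *)
pose dg t := \sum_i v 0 i * partial i f (z + t *: v) - (A + t * H).
have := @mean_value_le R (fun t => f (z + t *: v) - (t * A + 2^-1 * t ^+ 2 * H)) dg
  0 1 0 (eps * W ^+ 2).
rewrite min_l ?ler01 // max_r ?ler01 // subr0 normr1 !mulr1 scale0r scale1r addr0 => mv.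
have := mv _; rewrite !mul0r !mul1r expr0n /= expr1n !mulr0 !mul0r !addr0 !subr0 !mulr1.
have -> : f (z + v) - (A + 2^-1 * H) - f z = f (z + v) - f z - A - 2^-1 * H by ring.
apply=> t t0 t1.
have := seg t t0 t1; rewrite lt_min => /andP[st0 st1].
split.
  apply: is_deriveB.
    have /C2[_ _ cf _ _] := hU _ st0.
    have [|dv <-] := is_derive_C1 v _ cf; last exact: is_derive_line.
    by apply: filterS (nU _ (hU _ st0)) => y /C2[].
  exact: is_derive_quadratic.
rewrite subr0.
have -> : dg t = \sum_i v 0 i *
    (partial i f (z + t *: v) - partial i f z - \sum_j (t *: v) 0 j * partial j (partial i f) p).
  rewrite /dg opprD addrA -sumrB mulr_sumr -sumrB; apply: eq_bigr => i _.
  rewrite !mulrBr; congr (_ - _); rewrite !mulr_sumr.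
  by apply: eq_bigr => j _; rewrite mxE; ring.
apply: le_trans (ler_norm_sum _ _ _) _.
rewrite expr2 mulrCA [leRHS]mulr_suml; apply: ler_sum => i _.
rewrite normrM ler_wpM2l //.
move: zp; rewrite lt_min => /andP[_ zp1].
have := @coord_lipschitz R n (partial i f) (fun j => partial j (partial i f) p) p d1 eps
  (fun y yp => hd1 y yp i) z (t *: v) zp1 st1.
move=> /le_trans; apply; rewrite ler_wpM2l ?(ltW eps0) //; apply: ler_sum => j _.
by rewrite mxE normrM ger0_norm // ler_piMl.
Qed.

(** * The projective map attached to a quadric *)

Definition lform {R : realType} {n : nat} (G : 'cV[R]_n) (v : 'rV[R]_n) : R := (v *m G) 0 0.

Lemma lformZ {R : realType} {n : nat} (G : 'cV[R]_n) a (v : 'rV[R]_n) :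
  lform G (a *: v) = a * lform G v.
Proof. by rewrite /lform -scalemxAl mxE. Qed.

Lemma enorm_lt {R : realType} {n : nat} (v : 'rV[R]_n) (r : R) :
  0 < r -> (enorm v < r) = (sqn v < r ^+ 2).
Proof.
move=> r0; rewrite /enorm -/(sqn v) -[in LHS](ger0_norm (ltW r0)) -sqrtr_sqr.
by rewrite ltr_sqrt // exprn_gt0.
Qed.

(** A radius above 1 would put a coordinate vector, which exists as [0 < n], into the image of [D],
    hence into the open unit ball. *)
Lemma squeezing_near1 {R : realType} {n : nat} (D : set 'rV[R]_n) (z : 'rV[R]_n) (r : R) :
  (0 < n)%N -> squeeze_radii D z r -> r <= squeezing D z <= 1.
Proof.
move=> n0 rD.
have ub1 : ubound (squeeze_radii D z) 1.
  move=> t [t0 [A [_ _ _ inB cov]]]; rewrite leNgt; apply/negP => t1.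
  have [x Dx xE] : (proj_map A @` D) (ebasis (Ordinal n0)).
    apply: cov; rewrite /eball /= subr0 enorm_lt //.
    suff -> : sqn (ebasis (Ordinal n0) : 'rV[R]_n) = 1 by rewrite exprn_egt1.
    rewrite /sqn (bigD1 (Ordinal n0)) //= big1 => [|i i0]; rewrite !mxE eqxx /= ?eqxx.
      by rewrite expr1n addr0.
    by rewrite (negPf i0) expr0n.
  have := inB x Dx; rewrite xE /eball /= subr0 enorm_lt // expr1n.
  rewrite ltNge => /negP; apply; rewrite /sqn (bigD1 (Ordinal n0)) //= !mxE !eqxx expr1n.
  by rewrite lerDl sumr_ge0 // => i _; exact: sqr_ge0.
rewrite /squeezing; case: pselect => [h|[]]; last by exists r.
apply/andP; split; first by apply: ub_le_sup => //; exists 1.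
by apply: ge_sup => //; exists r.
Qed.

(** The last hypothesis encodes covering: the preimage of [u *m S] is [z + t *: u], where [t] solves
    [t = sg - lform G (t *: u) / (2 * sg)]. *)
Lemma squeeze_radiiP {R : realType} {n : nat} (D : set 'rV[R]_n) (z : 'rV[R]_n)
    (P : 'M[R]_n) (G : 'cV[R]_n) (sg r : R) :
  0 < sg -> 0 < r ->
  (forall v : 'rV_n, v != 0 -> 0 < qform P v) ->
  (forall x, D x -> qform P (x - z) < (sg - lform G (x - z) / (2 * sg)) ^+ 2) ->
  (forall u, qform P u < r ^+ 2 ->
     0 < 1 + lform G u / (2 * sg) /\ D (z + (sg / (1 + lform G u / (2 * sg))) *: u)) ->
  squeeze_radii D z r.
Proof.
move=> sg0 r0 /cholesky_qform[S Su PS] hout hin; split => //.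
(* [T] moves [z] to the origin; the first column of [B] yields the denominator, the others the
   numerator. *)
pose T : 'M[R]_(1 + n) := block_mx 1%:M (- z) 0 1%:M.
pose B : 'M[R]_(1 + n) := block_mx sg%:M 0 (- (2 * sg)^-1 *: G) S.
pose den x := sg - lform G (x - z) / (2 * sg).
have hE x : homog x *m (T *m B) = row_mx (den x)%:M ((x - z) *m S).
  rewrite mulmxA /homog.
  have -> : const_mx 1 = 1%:M :> 'M[R]_1 by apply/matrixP => i j; rewrite !ord1 !mxE eqxx.
  rewrite !mul_row_block !mul1mx !mulmx0 !addr0 mulmx1 mul1mx add0r [- z + x]addrC.
  congr row_mx; rewrite -scalemxAr /den /lform; set c := (x - z) *m G; clearbody c.
  by apply/matrixP => i j; rewrite !ord1 !mxE !eqxx !mulr1n; ring.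
have dE x : lsubmx (homog x *m (T *m B)) 0 0 = den x.
  by rewrite hE row_mxKl mxE eqxx mulr1n.
have pE x : proj_map (T *m B) x = (den x)^-1 *: ((x - z) *m S).
  by rewrite /proj_map dE hE row_mxKr.
(* At a zero of [den], [hout] would make a squared norm negative. *)
have den0 x : D x -> den x != 0.
  move=> /hout; rewrite PS -/(den x); apply: contraTneq => ->.
  by rewrite expr0n /= -leNgt sqn_ge0.
exists (T *m B); split.
- rewrite unitmx_mul; apply/andP; split; rewrite unitmxE ?det_ublock ?det_lblock ?det_scalar1 ?det1.
    by rewrite mulr1 unitr1.
  by rewrite unitrM unitfE gt_eqF //= -unitmxE.
- by move=> x /den0; rewrite /proj_defined dE.
- by rewrite pE subrr mul0mx scaler0.
- move=> x Dx; rewrite /eball /= subr0 enorm_lt // pE sqnZ -PS exprVn expr1n.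
  rewrite ltr_pdivrMl ?mulr1 ?exprn_even_gt0 //=; first exact: hout.
  exact: den0.
- move=> y; rewrite /eball /= subr0 enorm_lt // => yr.
  pose u := y *m invmx S.
  have uS : u *m S = y by rewrite mulmxKV.
  have [] := hin u; first by rewrite PS uS.
  set a := 1 + _; set t := sg / a => a0 Dx.
  exists (z + t *: u) => //.
  rewrite pE /den [z + t *: u]addrC addrK -scalemxAl uS scalerA.
  suff -> : sg - lform G (t *: u) / (2 * sg) = t.
    by rewrite mulVf ?scale1r // gt_eqF // divr_gt0.
  rewrite lformZ; have : t * a = sg by rewrite /t divfK // gt_eqF.
  by rewrite /a mulrDr mulr1 mulrA => {1}<-; ring.
Qed.

(** * Coercivity from positivity on a hyperplane *)

Lemma qformD {R : realType} {n : nat} (P Q : 'M[R]_n) (v : 'rV[R]_n) :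
  qform (P + Q) v = qform P v + qform Q v.
Proof. by rewrite /qform mulmxDr mulmxDl mxE. Qed.

Lemma qformZl {R : realType} {n : nat} (a : R) (P : 'M[R]_n) (v : 'rV[R]_n) :
  qform (a *: P) v = a * qform P v.
Proof. by rewrite /qform -scalemxAr -scalemxAl mxE. Qed.

Lemma continuous_qform {R : realType} {n : nat} (P : 'M[R]_n) : continuous (qform P).
Proof.
have -> : qform P = fun v => \sum_i \sum_j v 0 i * v 0 j * P i j.
  by apply/funext => v; exact: qform_sum.
apply: continuous_big => [|i _]; first exact: add_continuous.
apply: continuous_big => [|j _]; first exact: add_continuous.
move=> v; have := cvgM (cvgM (@coord_continuous R 1 n 0 i v)
  (@coord_continuous R 1 n 0 j v)) (cvg_cst (P i j)).
by apply.
Qed.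

Lemma qform1 {R : realType} {n : nat} (v : 'rV[R]_n) : qform 1%:M v = sqn v.
Proof. by rewrite /qform mulmx1 sqn_mul. Qed.

Lemma qform_lform2 {R : realType} {n : nat} (G : 'cV[R]_n) (v : 'rV[R]_n) :
  qform (G *m G^T) v = lform G v ^+ 2.
Proof.
rewrite /qform mulmxA -mulmxA -trmx_mul /lform; set c := v *m G; clearbody c.
by rewrite mxE big_ord1 !mxE expr2.
Qed.

Lemma norm_le_sqn {R : realType} {n : nat} (v : 'rV[R]_n) : `|v| ^+ 2 <= sqn v.
Proof.
have h : `|v| <= Num.sqrt (sqn v).
  apply: normv_le => [|i]; first exact: sqrtr_ge0.
  rewrite -sqrtr_sqr ler_sqrt ?sqn_ge0 // /sqn (bigD1 i) //= lerDl.
  by apply: sumr_ge0 => j _; exact: sqr_ge0.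
by rewrite -[leRHS]sqr_sqrtr ?sqn_ge0 // ler_sqr ?nnegrE ?sqrtr_ge0.
Qed.

Lemma compact_pos_min {T : topologicalType} {R : realType} (f : T -> R) (K : set T) :
  compact K -> continuous f -> (forall x, K x -> 0 < f x) ->
  exists2 m, 0 < m & forall x, K x -> m <= f x.
Proof.
move=> cK cf f0; have [->|/set0P K0] := eqVneq K set0; first by exists 1.
have [c /set_mem Kc hc] := compact_EVT_min K0 cK (continuous_subspaceT cf).
by exists (f c); [exact: f0|move=> x Kx; exact: hc (mem_set Kx)].
Qed.

(** On the unit sphere, the set where [qform H] is nonpositive is compact and avoids the kernel of
    [lform G], so a large multiple of the squared linear form restores positivity; homogeneity
    extends the bound. *)
Lemma coercive_on_kernel {R : realType} {n : nat} (H : 'M[R]_n) (G : 'cV[R]_n) :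
  (forall v : 'rV_n, v != 0 -> lform G v = 0 -> 0 < qform H v) ->
  exists C c : R, [/\ 0 <= C, 0 < c & forall v, c * sqn v <= qform H v + C * lform G v ^+ 2].
Proof.
move=> pos.
pose Sph := [set v : 'rV[R]_n | sqn v = 1].
have cq (P : 'M[R]_n) : continuous (qform P) := @continuous_qform R n P.
have cSph : compact Sph.
  apply: bounded_closed_compact.
    exists 1; split=> // x x1 v /= v1; apply: le_trans (ltW x1).
    by rewrite -[leRHS]sqrtr1 -v1 -[leLHS]ger0_norm // -sqrtr_sqr ler_sqrt ?sqn_ge0 // norm_le_sqn.
  have -> : Sph = qform 1%:M @^-1` [set 1] by apply/seteqP; split=> v /=; rewrite qform1.
  apply: preimage_closed => [v _|]; first exact: cq.
  exact: closed_eq.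
have Sph0 v : Sph v -> v != 0.
  by rewrite /Sph /=; apply: contra_eqN => /eqP ->; rewrite sqn_mul mul0mx mxE eq_sym oner_eq0.
have [m m0 hm] : exists2 m, 0 < m & forall v,
    (Sph `&` [set v | qform H v <= 0]) v -> m <= lform G v ^+ 2.
  have cK : compact (Sph `&` [set v | qform H v <= 0]).
    apply: compact_closedI => //.
    have -> : [set v | qform H v <= 0] = qform H @^-1` [set x | x <= 0] by [].
    by apply: preimage_closed => [v _|]; [exact: cq|exact: closed_le].
  have [v [/Sph0 v0 /= Hv]|m m0 hm] := compact_pos_min cK (cq (G *m G^T)).
    rewrite qform_lform2 exprn_even_gt0 //=.
    by apply: contraTneq Hv => /(pos v v0); rewrite ltNge.
  by exists m => // v /hm; rewrite qform_lform2.
have [B hB] : exists B, forall v, Sph v -> - B <= qform H v.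
  have [[v0 Sv0]|noS] := pselect (Sph !=set0).
    have [c _ hc] := compact_EVT_min (ex_intro _ v0 Sv0) cSph (continuous_subspaceT (cq H)).
    by exists (- qform H c) => v Sv; rewrite opprK; exact: hc (mem_set Sv).
  by exists 0 => v Sv; case: noS; exists v.
(* Makes [C * m] exceed [B], hence [- qform H v] on the sphere. *)
pose C := (`|B| + 1) / m.
have C0 : 0 <= C by rewrite divr_ge0 ?addr_ge0 // ltW.
have [v Sv|c c0 hc] := compact_pos_min cSph (cq (H + C *: (G *m G^T))).
  rewrite qformD qformZl qform_lform2.
  have [Hv|Hv] := leP (qform H v) 0; last by rewrite ltr_wpDr // mulr_ge0 ?sqr_ge0.
  have : C * m <= C * lform G v ^+ 2 by rewrite ler_wpM2l // hm.
  rewrite /C divfK ?gt_eqF //; have := hB v Sv; have := ler_norm B; lra.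
exists C, c; split=> // v.
have [->|v0] := eqVneq v 0.
  by rewrite -(scale0r (0 : 'rV[R]_n)) sqnZ qformZ lformZ !expr0n /= !mul0r expr0n /= !mulr0 addr0.
have sv := sqn_gt0 v0; pose a := Num.sqrt (sqn v).
have a0 : 0 < a by rewrite sqrtr_gt0.
have aE : a ^+ 2 = sqn v by rewrite sqr_sqrtr // ltW.
have := hc (a^-1 *: v).
rewrite /Sph /= sqnZ exprVn aE mulVf ?gt_eqF // => /(_ erefl).
rewrite qformZ qformD qformZl qform_lform2 exprVn aE ler_pdivlMl //.
by rewrite mulrC.
Qed.

(** * Squeezing near a strictly convex boundary point *)

Lemma sqr_lt_bound {R : realType} (x a : R) : 0 <= a -> x ^+ 2 < a ^+ 2 -> - a < x.
Proof.
by move=> a0; rewrite -(real_normK (num_real x)) ltr_sqr ?nnegrE // ltr_norml => /andP[].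
Qed.

(** The analysis enters only through inequalities: [outer] and [inner] sandwich [D] between two
    quadrics within sup-norm distance [d] of [z], and [far] treats distance exactly [d], from which
    convexity reaches the rest. *)
Lemma squeeze_radii_model {R : realType} {n : nat} (D : set 'rV[R]_n) (z : 'rV[R]_n)
    (H : 'M[R]_n) (G : 'cV[R]_n) (s M eps c C d r : R) :
  0 < s -> 0 < r -> r < 1 -> 0 < c -> 0 <= C -> 0 <= M -> 0 < eps -> eps <= c / 4 -> 0 < d ->
  convex_domain_set D -> D z ->
  (forall v, c * sqn v <= qform H v + C * lform G v ^+ 2) ->
  (forall v, `|v| <= d -> D (z + v) ->
     - s + lform G v + 2^-1 * qform H v - eps * sqn v < 0) ->
  (forall v, `|v| <= d -> - s + lform G v + 2^-1 * qform H v + eps * sqn v < 0 ->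
     D (z + v)) ->
  (forall v, `|v| = d -> - s + lform G v + 2^-1 * qform H v - eps * sqn v < 0 ->
     `|lform G v| + 2^-1 * qform H v <= M * lform G v ^+ 2) ->
  4 * s * (M + C / 2) <= 1 - r ->
  16 * s <= c * (1 - r) ^+ 2 * d ^+ 2 ->
  4 * M * s + 8 * eps / c <= 1 - r ^+ 2 ->
  squeeze_radii D z r.
Proof.
move=> s0 r0 r1 c0 C0 M0 e0 ec d0 cvxD Dz coer outer inner far sm1 sm2 sm3.
(* [P v < (sg - lform G v / (2 * sg)) ^+ 2], with [sg ^+ 2 = s], is the outer quadric
   [- s + lform G v + qform H v / 2 - eps * sqn v - M * lform G v ^+ 2 < 0]. *)
pose k := (4 * s)^-1 - M.
pose P := 2^-1 *: H + (- eps) *: 1%:M + k *: (G *m G^T).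
have PE v : qform P v = 2^-1 * qform H v - eps * sqn v + k * lform G v ^+ 2.
  by rewrite /P !qformD !qformZl qform1 qform_lform2 mulNr.
(* This is [sm1] divided by [4 * s]. *)
have kC : r / (4 * s) <= k - C / 2.
  rewrite ler_pdivrMr ?mulr_gt0 // /k mulrBl mulrBl mulVf ?gt_eqF ?mulr_gt0 //; lra.
have rs0 : 0 <= r / (4 * s) by apply: divr_ge0; lra.
have PL v : c / 4 * sqn v + r / (4 * s) * lform G v ^+ 2 <= qform P v.
  rewrite PE; have := coer v; have := ler_wpM2r (sqr_ge0 (lform G v)) kC.
  have := ler_wpM2r (sqn_ge0 v) ec; lra.
pose sg := Num.sqrt s.
have sg0 : 0 < sg by rewrite sqrtr_gt0.
have sgE : sg ^+ 2 = s by rewrite sqr_sqrtr // ltW.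
apply: (@squeeze_radiiP R n D z P G sg r) => //.
- move=> v v0; apply: lt_le_trans (PL v); apply: ltr_pwDl.
    by rewrite mulr_gt0 ?divr_gt0 ?sqn_gt0.
  exact: mulr_ge0 rs0 (sqr_ge0 _).
- move=> x Dx; set v := x - z.
  have -> : (sg - lform G v / (2 * sg)) ^+ 2 = s - lform G v + (4 * s)^-1 * lform G v ^+ 2.
    by rewrite -sgE; field; rewrite gt_eqF.
  suff : - s + lform G v + 2^-1 * qform H v - eps * sqn v - M * lform G v ^+ 2 < 0.
    rewrite PE /k mulrBl; lra.
  have xE : x = z + v by rewrite /v addrC subrK.
  have ML := mulr_ge0 M0 (sqr_ge0 (lform G v)).
  have [vd|vd] := leP `|v| d.
    by have := outer v vd; rewrite -xE => /(_ Dx); lra.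
  have v0 : 0 < `|v| by exact: lt_trans vd.
  (* By convexity the far point [v] is a multiple [t *: w] of a point [w] of [D - z]
     on the sphere of radius [d], where [far] applies. *)
  pose t := `|v| / d; pose w := t^-1 *: v.
  have t1 : 1 < t by rewrite ltr_pdivlMr // mul1r.
  have t0 : 0 < t by exact: lt_trans t1.
  have wd : `|w| = d.
    by rewrite normrZ normfV gtr0_norm // /t invfM invrK mulrAC mulVf ?mul1r // gt_eqF.
  have vE : v = t *: w by rewrite scalerA mulfV ?scale1r // gt_eqF.
  have Dw : D (z + w).
    have -> : z + w = (1 - t^-1) *: z + t^-1 *: x.
      by rewrite xE scalerDr addrA -scalerDl subrK scale1r.
    by apply: cvxD => //; rewrite ?invr_ge0 ?(ltW t0) // invf_le1 // ltW.
  have wout := outer w (eq_ind_r (fun y => y <= d) (lexx d) wd) Dw.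
  have := far w wd wout; rewrite vE (lformZ _ t w) (qformZ _ t w) (sqnZ t w).
  have := ler_norm (lform G w); have := sqn_ge0 w.
  set l := lform G w; set h := qform H w; set q := sqn w => q0 ll far'.
  (* As [1 < t], the linear term is dominated by the quadratic scaling; hence the absolute value in
     [far]. *)
  have h1 : t * l <= t ^+ 2 * `|l|.
    apply: (@le_trans _ _ (t * `|l|)); first by rewrite ler_wpM2l // ltW.
    by rewrite ler_wpM2r // expr2 ler_peMl // ltW.
  have h2 := ler_wpM2l (sqr_ge0 t) far'.
  have h3 := mulr_ge0 (ltW e0) (mulr_ge0 (sqr_ge0 t) q0).
  lra.
- move=> u Pu; have PLu := PL u.
  pose l := lform G u / (2 * sg).
  have lE : lform G u = 2 * sg * l by rewrite /l mulrC divfK // gt_eqF // mulr_gt0.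
  have l2 : l ^+ 2 < r.
    have : r / (4 * s) * lform G u ^+ 2 < r ^+ 2.
      apply: le_lt_trans Pu; apply: le_trans PLu.
      by rewrite lerDr mulr_ge0 ?sqn_ge0 // divr_ge0 // ltW.
    have -> : r / (4 * s) * lform G u ^+ 2 = r * l ^+ 2.
      by rewrite lE -sgE; field; rewrite gt_eqF.
    by rewrite expr2 ltr_pM2l.
  (* The square of [(1 + r) / 2] exceeds [r] by that of [(1 - r) / 2]. *)
  have lr : (1 - r) / 2 < 1 + l.
    have : - ((1 + r) / 2) < l.
      apply: sqr_lt_bound; first lra.
      have := sqr_ge0 (1 - r); nra.
    lra.
  have l10 : 0 < 1 + l by lra.
  have Eu : sqn u <= 4 / c.
    have : c / 4 * sqn u < r ^+ 2.
      apply: le_lt_trans Pu; apply: le_trans PLu; rewrite lerDl.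
      exact: mulr_ge0 rs0 (sqr_ge0 _).
    have : r ^+ 2 <= 1 by rewrite exprn_ile1 // ltW.
    rewrite ler_pdivlMr //; lra.
  split => //; rewrite -/l; set t := sg / (1 + l).
  have t0 : 0 < t by rewrite divr_gt0.
  have tE : sg = t * (1 + l) by rewrite /t divfK // gt_eqF.
  have t2 : t ^+ 2 * (1 - r) ^+ 2 <= 4 * s.
    rewrite -sgE tE; have : (1 - r) ^+ 2 <= (2 * (1 + l)) ^+ 2 by rewrite ler_sqr ?nnegrE; lra.
    move=> /(ler_wpM2l (sqr_ge0 t)); lra.
  (* For the norm bound, [t2] and [Eu] make the squared norm of [t *: u] at most
     [16 * s / (c * (1 - r) ^+ 2)], which [sm2] compares with [d ^+ 2]. *)
  apply: inner.
    rewrite -ler_sqr ?nnegrE ?normr_ge0 ?(ltW d0) // normrZ exprMn gtr0_norm //.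
    have h1 : `|u| ^+ 2 * c <= 4.
      by rewrite -ler_pdivlMr //; apply: le_trans (norm_le_sqn u) Eu.
    have h2 : 0 < c * (1 - r) ^+ 2 by rewrite mulr_gt0 // exprn_gt0 // subr_gt0.
    rewrite -(ler_pM2l h2); apply: le_trans sm2.
    have := ler_pM (mulr_ge0 (sqr_ge0 t) (sqr_ge0 (1 - r))) (mulr_ge0 (sqr_ge0 _) (ltW c0)) t2 h1.
    lra.
  rewrite lformZ qformZ sqnZ.
  (* With [s = t ^+ 2 * (1 + l) ^+ 2] and [lform G u = 2 * t * (1 + l) * l], the first two terms
     become [t ^+ 2 * (l ^+ 2 - 1)]. The bracket is negative by [sm3]. *)
  have -> : - s + t * lform G u + 2^-1 * (t ^+ 2 * qform H u) + eps * (t ^+ 2 * sqn u) =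
    t ^+ 2 * (qform P u - 1 + 4 * M * s * l ^+ 2 + 2 * eps * sqn u).
    rewrite PE /k lE -sgE tE; field. rewrite ?gt_eqF //.
  rewrite pmulr_rlt0 ?exprn_gt0 //.
  have h1 : 4 * M * s * l ^+ 2 <= 4 * M * s.
    by rewrite ler_piMr ?mulr_ge0 ?(ltW s0) //; lra.
  have h2 : 2 * eps * sqn u <= 8 * eps / c.
    have := ler_wpM2l (ltW e0) Eu; lra.
  lra.
Qed.

(** * Constants uniform in the base point *)

Definition gradient {R : realType} {n : nat} (f : 'rV[R]_n -> R) (x : 'rV[R]_n) : 'cV[R]_n :=
  \col_i partial i f x.

Definition hessian {R : realType} {n : nat} (f : 'rV[R]_n -> R) (x : 'rV[R]_n) : 'M[R]_n :=
  \matrix_(i, j) partial j (partial i f) x.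

Lemma lform_gradient {R : realType} {n : nat} (f : 'rV[R]_n -> R) (x v : 'rV[R]_n) :
  lform (gradient f x) v = \sum_i v 0 i * partial i f x.
Proof. by rewrite /lform mxE; apply: eq_bigr => i _; rewrite mxE. Qed.

Lemma qform_hessian {R : realType} {n : nat} (f : 'rV[R]_n -> R) (x v : 'rV[R]_n) :
  qform (hessian f x) v = \sum_i \sum_j v 0 i * v 0 j * partial j (partial i f) x.
Proof.
by rewrite qform_sum; apply: eq_bigr => i _; apply: eq_bigr => j _; rewrite mxE.
Qed.

Lemma sum_norm_sqr_le {R : realType} {n : nat} (v : 'rV[R]_n) :
  (\sum_i `|v 0 i|) ^+ 2 <= n%:R ^+ 2 * sqn v.
Proof.
apply: (@le_trans _ _ ((n%:R * `|v|) ^+ 2)).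
  rewrite ler_sqr ?nnegrE ?sumr_ge0 ?mulr_ge0 //.
  rewrite -[X in X%:R](card_ord n) mulr_natl -sumr_const.
  by apply: ler_sum => i _; exact: normv_coord.
by rewrite exprMn ler_wpM2l ?sqr_ge0 // norm_le_sqn.
Qed.

(** Bounding [lform (G p) v ^+ 2] by twice [lform (G z) v ^+ 2] plus twice the squared difference
    doubles [C]; near [p] the difference costs at most half of [c]. *)
Lemma coercive_near {R : realType} {n : nat} (H : 'M[R]_n)
    (G : 'rV[R]_n -> 'cV[R]_n) (p : 'rV[R]_n) :
  (forall i, (fun x => G x i 0) @ p --> G p i 0) ->
  (forall v : 'rV_n, v != 0 -> lform (G p) v = 0 -> 0 < qform H v) ->
  exists C c : R, [/\ 0 <= C, 0 < c & \forall z \near p, forall v,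
    c * sqn v <= qform H v + C * lform (G z) v ^+ 2].
Proof.
move=> cG /coercive_on_kernel[C [c [C0 c0 hC]]].
exists (2 * C), (c / 2); split; [lra|lra|].
(* The error is at most [2 * C * eta ^+ 2 * n%:R ^+ 2 * sqn v], so [eta ^+ 2 * K <= c] suffices. *)
pose K := 4 * C * n%:R ^+ 2 + 1.
have K0 : 0 < K by rewrite ltr_wpDl // !mulr_ge0 ?sqr_ge0.
pose eta := Num.min 1 (c / K).
have eta0 : 0 < eta by rewrite lt_min ltr01 divr_gt0.
have near_eta : \forall z \near p, forall i, `|G p i 0 - G z i 0| <= eta.
  apply: (@filter_forall _ _ (fun i z => `|G p i 0 - G z i 0| <= eta) (nbhs p) _) => i.
  by have /cvgrPdist_le/(_ _ eta0) := cG i.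
apply: filterS near_eta => z hz v; have := hC v.
pose W := \sum_i `|v 0 i|.
have hd : `|lform (G p) v - lform (G z) v| <= eta * W.
  rewrite /lform !mxE -sumrB mulr_sumr; apply: le_trans (ler_norm_sum _ _ _) _.
  by apply: ler_sum => i _; rewrite -mulrBr normrM mulrC ler_wpM2r.
have hd2 : (lform (G p) v - lform (G z) v) ^+ 2 <= eta ^+ 2 * W ^+ 2.
  by rewrite -exprMn -[leLHS]real_normK ?num_real // ler_sqr ?nnegrE // mulr_ge0 ?sumr_ge0 // ltW.
have e2 : eta ^+ 2 * K <= c.
  apply: (@le_trans _ _ (eta * K)).
    by rewrite ler_wpM2r ?(ltW K0) // expr2 ler_piMr ?(ltW eta0) // ge_min lexx.
  by rewrite -ler_pdivlMr // ge_min lexx orbT.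
have h1 : eta ^+ 2 * W ^+ 2 <= eta ^+ 2 * (n%:R ^+ 2 * sqn v).
  by rewrite ler_wpM2l ?sqr_ge0 // sum_norm_sqr_le.
have h2 := ler_wpM2r (sqn_ge0 v) e2.
have h3 : 4 * C * (lform (G p) v - lform (G z) v) ^+ 2 <= 4 * C * (eta ^+ 2 * (n%:R ^+ 2 * sqn v)).
  by rewrite ler_wpM2l ?mulr_ge0 //; apply: le_trans hd2 h1.
have h4 : 0 <= eta ^+ 2 * sqn v by rewrite mulr_ge0 ?sqr_ge0 ?sqn_ge0.
have h5 : C * lform (G p) v ^+ 2 <=
    C * (2 * lform (G z) v ^+ 2 + 2 * (lform (G p) v - lform (G z) v) ^+ 2).
  by rewrite ler_wpM2l //; have := sqr_ge0 (2 * lform (G z) v - lform (G p) v); nra.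
move: h2; rewrite /K; lra.
Qed.

(** Supplies the [M] of [far], with [x] the linear form and [B] a bound on the Hessian term. The
    hypothesis keeps [|x|] above some [m <= 1], so [|x|] and [B] are absorbed by
    [x ^+ 2 / m ^+ 2]. *)
Lemma quadratic_majorant {R : realType} (k C B : R) : 0 < k -> 0 <= C -> 0 <= B ->
  exists2 M : R, 0 <= M & forall x, x - C / 2 * x ^+ 2 < - k -> `|x| + B <= M * x ^+ 2.
Proof.
move=> k0 C0 B0; pose m := Num.min 1 (k / (1 + C / 2)).
have m0 : 0 < m by rewrite lt_min ltr01 divr_gt0 // ltr_wpDr // divr_ge0.
exists ((1 + B) / m ^+ 2); first by rewrite divr_ge0 ?sqr_ge0 // addr_ge0.
move=> x hx.
have x2 : x ^+ 2 = `|x| ^+ 2 by rewrite real_normK ?num_real.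
have ax := normr_ge0 x.
have mx : m <= `|x|.
  rewrite ge_min; have [//|x1] := leP 1 `|x|.
  rewrite /= ler_pdivrMr ?ltr_wpDr ?divr_ge0 //.
  have := ler_norm (- x); rewrite normrN => nx; move: hx; rewrite x2 => hx.
  have : C / 2 * `|x| ^+ 2 <= C / 2 * `|x|.
    by rewrite ler_wpM2l ?divr_ge0 // expr2 ler_piMl // ltW.
  lra.
have m1 : m <= 1 by rewrite ge_min lexx.
rewrite x2 mulrAC ler_pdivlMr ?exprn_gt0 //.
have h1 : m ^+ 2 <= `|x| ^+ 2 by rewrite ler_sqr ?nnegrE // ltW.
have h2 : m ^+ 2 * `|x| <= `|x| ^+ 2.
  rewrite [leRHS]expr2 ler_wpM2r //; apply: le_trans mx.
  by rewrite expr2 ler_piMl // ltW.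
have := ler_wpM2r B0 h1; lra.
Qed.

(** Constants are fixed in the order [eps], [d], [M], [s0]; as [M] does not depend on [z], moving
    [z] towards [p] makes [- rho z] small against it. *)
Lemma squeeze_radii_near {R : realType} {n : nat} (D : set 'rV[R]_n) (p : 'rV[R]_n) (r : R) :
  open D -> convex_domain_set D -> ~ D p -> strictly_convex_pt D p -> 0 < r -> r < 1 ->
  exists2 delta : R, 0 < delta & forall z, D z -> `|z - p| < delta -> squeeze_radii D z r.
Proof.
move=> oD cvxD nDp [U [rho [[oU Up] C2 defU _ posH]]] r0 r1.
have [crho _ cpartial _ _] := C2 p Up.
pose G := gradient rho; pose H := hessian rho p.
have rho_p : 0 <= rho p by rewrite leNgt; by apply/negP => /(defU p Up).
have [C [c [C0 c0 /near_ball[d1 d10 coer]]]] : exists C c : R,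
    [/\ 0 <= C, 0 < c & \forall z \near p, forall v, c * sqn v <= qform H v + C * lform (G z) v ^+ 2].
  apply: coercive_near => [i|v v0].
    have -> : (fun x => G x i 0) = partial i rho by apply/funext => x; rewrite /G mxE.
    by rewrite /G mxE; exact: cpartial.
  by rewrite lform_gradient qform_hessian; exact: posH.
have [dU dU0 hU] : exists2 d : R, 0 < d & forall y, `|y - p| < d -> U y.
  by apply: near_ball; exact: open_nbhs_nbhs.
have r1' : 0 < 1 - r by rewrite subr_gt0.
have r2 : 0 < 1 - r ^+ 2 by rewrite subr_gt0 expr_lt1 // ltW.
(* The second bound gives [8 * eps / c] half of the room [1 - r ^+ 2]; [4 * M * s] gets the other
   half. *)
pose eps := Num.min (c / 4) (c * (1 - r ^+ 2) / 16).
have eps0 : 0 < eps by rewrite lt_min !divr_gt0 // mulr_gt0.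
have epsc : eps <= c / 4 by rewrite ge_min lexx.
have epsr : eps <= c * (1 - r ^+ 2) / 16 by rewrite ge_min lexx orbT.
have N0 : 0 < n%:R ^+ 2 + 1 :> R by rewrite ltr_wpDl ?sqr_ge0.
(* [sum_norm_sqr_le] turns this tolerance into an error [eps * sqn v]. *)
have [d2 d20 tay] := taylor2 oU Up C2 (divr_gt0 eps0 N0).
pose d3 := Num.min d1 (Num.min dU d2).
have d30 : 0 < d3 by rewrite !lt_min d10 dU0.
have d31 : d3 <= d1 by rewrite ge_min lexx.
have d3U : d3 <= dU by rewrite !ge_min lexx orbT.
have d32 : d3 <= d2 by rewrite !ge_min lexx !orbT.
pose d := d3 / 3.
have d0 : 0 < d by rewrite divr_gt0.
have tayE z v : `|z - p| < d -> `|v| <= d ->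
    [/\ U z, U (z + v) & `|rho (z + v) - rho z - lform (G z) v - 2^-1 * qform H v| <= eps * sqn v].
  move=> zp vd.
  have z3 : `|z - p| < d3 by apply: lt_trans zp _; rewrite /d; lra.
  have zv3 : `|z + v - p| < d3.
    by rewrite addrAC; apply: le_lt_trans (ler_normD _ _) _; move: zp vd; rewrite /d; lra.
  split; [exact: hU (lt_le_trans z3 d3U)|exact: hU (lt_le_trans zv3 d3U)|].
  rewrite lform_gradient qform_hessian.
  apply: le_trans (tay z v (lt_le_trans z3 d32) (lt_le_trans zv3 d32)) _.
  rewrite -mulrA ler_pM2l // ler_pdivrMl //; apply: le_trans (sum_norm_sqr_le v) _.
  by rewrite ler_wpM2r ?sqn_ge0 // lerDl.
pose B := 2^-1 * (d ^+ 2 * \sum_i \sum_j `|H i j|).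
have B0 : 0 <= B.
  apply: mulr_ge0 => //; apply: mulr_ge0; first exact: sqr_ge0.
  by apply: sumr_ge0 => i _; exact: sumr_ge0.
have HB v : `|v| = d -> 2^-1 * qform H v <= B.
  move=> vd; rewrite ler_pM2l ?invr_gt0 // qform_sum mulr_sumr; apply: ler_sum => i _.
  rewrite mulr_sumr; apply: ler_sum => j _; apply: le_trans (ler_norm _) _.
  rewrite normrM ler_wpM2r // normrM expr2 -vd.
  by apply: ler_pM => //; exact: normv_coord.
(* On the sphere of radius [d], coercivity and [eps <= c / 4] turn the outer quadric into
   [x - C / 2 * x ^+ 2 < s - c * d ^+ 2 / 4], where [x] is the linear form; half of the last term
   absorbs [s]. *)
have k0 : 0 < c * d ^+ 2 / 8 by rewrite !mulr_gt0 ?exprn_gt0.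
have [M M0 hM] := quadratic_majorant k0 C0 B0.
have [s0 s00 hs0] : exists2 s0 : R, 0 < s0 & forall s, 0 < s -> s <= s0 ->
   [/\ s <= c * d ^+ 2 / 8, 4 * s * (M + C / 2) <= 1 - r,
       16 * s <= c * (1 - r) ^+ 2 * d ^+ 2 & 4 * M * s <= (1 - r ^+ 2) / 2].
  (* The [+ 1] covers a vanishing coefficient [a]. *)
  have lin (a b s : R) : 0 <= a -> s <= b / (a + 1) -> 0 < s -> a * s <= b.
    move=> a0; rewrite ler_pdivlMr ?ltr_wpDl //; lra.
  have a1 : 0 <= 4 * (M + C / 2) by lra.
  have a2 : 0 <= 4 * M by lra.
  exists (Num.min (Num.min (c * d ^+ 2 / 8) ((1 - r) / (4 * (M + C / 2) + 1)))
    (Num.min (c * (1 - r) ^+ 2 * d ^+ 2 / 16) ((1 - r ^+ 2) / 2 / (4 * M + 1)))).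
    rewrite !lt_min k0 (divr_gt0 r1' (ltr_wpDl a1 ltr01)) /=; apply/andP; split.
      by rewrite divr_gt0 // mulr_gt0 ?exprn_gt0 // mulr_gt0 // exprn_gt0.
    by rewrite (divr_gt0 _ (ltr_wpDl a2 ltr01)) // divr_gt0.
  move=> s s0; rewrite !le_min => /andP[/andP[h1 h2] /andP[h3 h4]]; split => //.
  - have := lin _ _ _ a1 h2 s0; lra.
  - lra.
  - exact: lin a2 h4 s0.
(* Continuity suffices because [rho p] is nonnegative. *)
have [d4 d40 hd4] : exists2 d4 : R, 0 < d4 & forall z, `|z - p| < d4 -> - rho z <= s0.
  apply: near_ball; have /cvgrPdist_le/(_ _ s00) := crho.
  by apply: filterS => z; rewrite ler_norml => /andP[_]; lra.
exists (Num.min d d4); first by rewrite lt_min d0.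
move=> z Dz; rewrite lt_min => /andP[zd zd4].
have Uz : U z by have [] := tayE z 0 zd; rewrite ?normr0 // ltW.
have s1 : 0 < - rho z by rewrite oppr_gt0; apply/defU.
have [sm0 sm1 sm2 sm3] := hs0 _ s1 (hd4 z zd4).
have zd1 : `|z - p| < d1 by apply: lt_le_trans zd _; move: d31; rewrite /d; lra.
have coerz := coer z zd1.
have out v : `|v| <= d -> D (z + v) ->
  - - rho z + lform (G z) v + 2^-1 * qform H v - eps * sqn v < 0.
  move=> vd Dv; have [_ Uv] := tayE z v zd vd; rewrite ler_norml => /andP[h _].
  by have /defU := Dv => /(_ Uv); lra.
apply: (@squeeze_radii_model R n D z H (G z) (- rho z) M eps c C d r) => //.
- move=> v vd vneg; have [_ Uv] := tayE z v zd vd; rewrite ler_norml => /andP[_ h].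
  by apply/defU => //; lra.
- move=> v vd vneg; apply: le_trans (hM _ _); first by rewrite lerD2l; exact: HB.
  have := coerz v; have := norm_le_sqn v; rewrite vd => E2 cE.
  have h1 := ler_wpM2l (ltW c0) E2; have h2 := ler_wpM2r (sqn_ge0 v) epsc; lra.
- have : 8 * eps / c <= (1 - r ^+ 2) / 2.
    rewrite ler_pdivrMr //; lra.
  lra.
Qed.

Lemma enorm_ge_norm {R : realType} {n : nat} (v : 'rV[R]_n) : `|v| <= enorm v.
Proof.
by rewrite -[leLHS]ger0_norm // -sqrtr_sqr ler_sqrt ?sqn_ge0 // norm_le_sqn.
Qed.

Unset Implicit Arguments. Set Strict Implicit.

Theorem theorem2 (R : realType) (n : nat) (D : set 'rV[R]_n) (p : 'rV[R]_n) :
  domain D -> convex_domain_set D -> boundary_pt D p -> strictly_convex_pt D p ->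
  forall eps : R, 0 < eps ->
    exists2 delta : R, 0 < delta &
      forall x, D x -> enorm (x - p) < delta -> `|squeezing D x - 1| < eps.
Proof.
move=> [oD _ _] cvxD [_ nintD] scp eps eps0.
have n0 : (0 < n)%N by have [U [rho [_ _ _ [i _] _]]] := scp; exact: leq_ltn_trans (ltn_ord i).
have nDp : ~ D p by move=> Dp; apply: nintD; move: oD; rewrite openE; apply.
(* The [1 / 2] keeps [r] positive when [eps] is large. *)
pose r := Num.max (1 / 2) (1 - eps / 2).
have r0 : 0 < r by rewrite lt_max divr_gt0.
have r1 : r < 1 by rewrite gt_max; apply/andP; split; lra.
have re : 1 - eps / 2 <= r by rewrite le_max lexx orbT.
have [delta delta0 hdelta] := squeeze_radii_near oD cvxD nDp scp r0 r1.
exists delta => // x Dx /(le_lt_trans (enorm_ge_norm _))/(hdelta x Dx).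
by move=> /(squeezing_near1 n0)/andP[h1 h2]; rewrite ltr_norml; lra.
Qed.
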